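(* Let (C1q), (C2q) and (C3q) hold (with rates $\sigma_1,\sigma_2,\sigma_3$). Put $Q:=\max\{\sigma_1(b_A-1)-1,0\}$ and let $K\in\mathbb{N}^*$ with $K\ge\max\left\{\|x_Q-p\|,\frac{\|u-Ap\|}{\gamma}\right\}$. Then $(x_n)$ is $(\tilde T_n)$-asymptotically regular with rate $\Phi$, that is, $$\forall k\in\mathbb{N}\ \forall n\ge\Phi(k)\ \left(\|x_n-\tilde T_nx_n\|\le\frac1{k+1}\right),$$ where $$\Phi(k)=\max\{\Sigma((l+1)(k+1)-1),\Psi((l+1)(k+1)-1)\},$$ $$\Sigma(k)=\sigma_2\left(\left\lceil\frac{\psi(2k+1)+\lceil\ln(4K(k+1))\rceil}{\gamma}\right\rceil+Q+l+1\right)-l,$$ $$\psi(k)=\max\left\{\sigma_3\left(\left\lceil\frac{(b_A+1)K}{\gamma}\right\rceil(k+1)-1\right)-Q-1,0\right\},$$ $$\Psi(k)=\max\{\sigma_1((b_A+1)K(k+1)-1)-1,0\}.$$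
   Context: $\mathbb{N}=\{0,1,2,\dots\}$, $\mathbb{N}^*=\mathbb{N}\setminus\{0\}$; subtractions are in $\mathbb{Z}$. Setting: $H$ is a real Hilbert space; $A$ is a self-adjoint bounded linear operator on $H$ with $\langle Ax,x\rangle\ge\gamma\|x\|^2$ for all $x\in H$, where $0<\gamma\le1$. $l\in\mathbb{N}$, $l\ge1$, and $T_0,\dots,T_{l-1}:H\to H$ are nonexpansive with $F:=\bigcap_{i=0}^{l-1}\mathrm{Fix}(T_i)\ne\emptyset$; for $n\ge l$, $T_n:=T_{n\bmod l}$; $\tilde T_i:=T_{i+l}\cdots T_{i+1}$ (composition) for $i\in\mathbb{N}$. $u\in H$, $(\alpha_n)_{n\in\mathbb{N}}\subset(0,1]$, and $(x_n)$ is Xu's iteration: $x_0\in H$, $x_{n+1}=(I-\alpha_{n+1}A)T_{n+1}x_n+\alpha_{n+1}u$. Take $p\in F$ and $b_A\in\mathbb{N}^*$ with $b_A\ge\|A\|$. Quantitative conditions (the rates $\sigma_i:\mathbb{N}\to\mathbb{N}$ are assumed increasing, i.e. nondecreasing): (C1q) $\forall k\,\forall n\ge\sigma_1(k)$: $\alpha_n\le\frac1{k+1}$. (C2q) $\forall k$: $\sum_{n=0}^{\sigma_2(k)}\alpha_n\ge k$. (C3q) $\forall k\,\forall n\ge\sigma_3(k)$: $\left|\frac{\alpha_n}{\alpha_{n+l}}-1\right|\le\frac1{k+1}$. *)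

(* Defs.v *)
From mathcomp Require Import all_boot all_order all_algebra.
From mathcomp Require Import all_classical all_reals all_analysis.

Set Implicit Arguments.
Unset Strict Implicit.
Unset Printing Implicit Defensive.

Import Order.TTheory GRing.Theory Num.Theory.
Import numFieldNormedType.Exports.

Local Open Scope classical_set_scope.
Local Open Scope ring_scope.

(* A real Hilbert space is a complete normed module [H] together with a
   positive definite symmetric bilinear form that induces its norm. *)
Definition induces_norm (R : realType) (H : completeNormedModType R)
    (dot : {dot H for idfun}) : Prop :=
  forall x : H, `|x| = Num.sqrt (dot x x).

Definition self_adjoint (R : realType) (H : completeNormedModType R)
    (dot : {dot H for idfun}) (A : H -> H) : Prop :=
  forall x y : H, dot (A x) y = dot x (A y).

Definition strongly_positive (R : realType) (H : completeNormedModType R)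
    (dot : {dot H for idfun}) (A : H -> H) (gamma : R) : Prop :=
  forall x : H, gamma * `|x| ^+ 2 <= dot (A x) x.

Definition bounded_operator (R : realType) (H : normedModType R)
    (A : H -> H) : Prop :=
  exists M : R, forall x : H, `|A x| <= M * `|x|.

(* [sup] is the real supremum: this is the operator norm when [A] is a bounded
   linear operator (the set is then nonempty and bounded). *)
Definition opnorm (R : realType) (H : normedModType R) (A : H -> H) : R :=
  sup [set `|A x| | x in [set x : H | `|x| <= 1]].

Definition nonexpansive (R : realType) (H : normedModType R)
    (S : H -> H) : Prop :=
  forall x y : H, `|S x - S y| <= `|x - y|.

Definition Fix (H : Type) (S : H -> H) : set H := [set x | S x = x].

(* [seqcomp T i m] is T_{i+m} o ... o T_{i+1}, with T_{i+1} applied first. *)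
Fixpoint seqcomp (H : Type) (T : nat -> H -> H) (i m : nat) (y : H) : H :=
  if m is m'.+1 then T (i + m)%N (seqcomp T i m' y) else y.

Definition Ttilde (H : Type) (T : nat -> H -> H) (l i : nat) : H -> H :=
  seqcomp T i l.

Definition xu_iteration (R : realType) (H : normedModType R) (A : H -> H)
    (T : nat -> H -> H) (u : H) (alpha : nat -> R) (x : nat -> H) : Prop :=
  forall n : nat,
    x n.+1 = (T n.+1 (x n) - alpha n.+1 *: A (T n.+1 (x n)))
             + alpha n.+1 *: u.

Definition C1q (R : realType) (alpha : nat -> R) (sigma1 : nat -> nat) : Prop :=
  forall k n : nat, (sigma1 k <= n)%N -> alpha n <= 1 / k.+1%:R.

Definition C2q (R : realType) (alpha : nat -> R) (sigma2 : nat -> nat) : Prop :=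
  forall k : nat, k%:R <= \sum_(0 <= n < (sigma2 k).+1) alpha n.

Definition C3q (R : realType) (alpha : nat -> R) (l : nat)
    (sigma3 : nat -> nat) : Prop :=
  forall k n : nat, (sigma3 k <= n)%N ->
    `|alpha n / alpha (n + l)%N - 1| <= 1 / k.+1%:R.

(* The ceiling as a natural number; only meaningful for [0 <= r], which holds
   at every use below. *)
Definition nceil (R : realType) (r : R) : nat := `|Num.ceil r|%N.

(* Subtraction on [nat] is truncated: [(m - n)%N] is max{m - n, 0}. *)
Definition rateQ (bA : nat) (sigma1 : nat -> nat) : nat :=
  (sigma1 (bA - 1) - 1)%N.

Definition ratepsi (R : realType) (gamma : R) (bA K : nat)
    (sigma1 sigma3 : nat -> nat) (k : nat) : nat :=
  (sigma3 (nceil ((bA + 1)%:R * K%:R / gamma) * (k + 1) - 1)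
    - rateQ bA sigma1 - 1)%N.

Definition ratePsi (bA K : nat) (sigma1 : nat -> nat) (k : nat) : nat :=
  (sigma1 ((bA + 1) * K * (k + 1) - 1) - 1)%N.

(* The final [- l] has no max with 0, so it is taken in [int]. *)
Definition rateSigma (R : realType) (gamma : R) (l bA K : nat)
    (sigma1 sigma2 sigma3 : nat -> nat) (k : nat) : int :=
  (sigma2 (nceil (((ratepsi gamma bA K sigma1 sigma3 (2 * k + 1))%:R
                   + (nceil (ln (4 * K%:R * (k + 1)%:R : R)))%:R) / gamma)
           + rateQ bA sigma1 + l + 1)%N)%:Z - l%:Z.

Definition ratePhi (R : realType) (gamma : R) (l bA K : nat)
    (sigma1 sigma2 sigma3 : nat -> nat) (k : nat) : int :=
  Num.max
    (rateSigma gamma l bA K sigma1 sigma2 sigma3 ((l + 1) * (k + 1) - 1)%N)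
    (ratePsi bA K sigma1 ((l + 1) * (k + 1) - 1)%N)%:Z.

Definition asymptotically_regular_with_rate (R : realType)
    (H : normedModType R) (S : nat -> H -> H) (x : nat -> H)
    (Phi : nat -> int) : Prop :=
  forall k n : nat, Phi k <= n%:Z -> `|x n - S n (x n)| <= 1 / k.+1%:R.

(* Main.v *)
Require Import Defs.
From mathcomp Require Import all_boot all_order all_algebra.
From mathcomp Require Import all_classical all_reals all_analysis.
From mathcomp Require Import zify ring lra.
Set Implicit Arguments.
Unset Strict Implicit.
Unset Printing Implicit Defensive.
Import Order.TTheory GRing.Theory Num.Theory.
Import numFieldNormedType.Exports.
Local Open Scope classical_set_scope.
Local Open Scope ring_scope.

(* Strong positivity of [A] makes [I - a A] a [(1 - a gamma)]-contraction as soon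
   as [a <= 1 / bA], that is, for every step after the index [Q].  Hence the
   iterates stay within [K] of [p] from [Q] on, and with [C = (bA + 1) K] one gets
   [|x_{n+1} - T_{n+1} x_n| <= alpha_{n+1} C] and
     [|x_{n+1+l} - x_{n+1}| <= (1 - a_n) |x_{n+l} - x_n| + a_n b_n],
   where [a_n = gamma alpha_{n+1+l}] and
   [b_n = |alpha_{n+1} / alpha_{n+1+l} - 1| C / gamma].  Since
   [1 - a_n <= exp (- a_n)], divergence of the sum of the [a_n] forces
   [|x_{n+l} - x_n|] to [0] at an explicit rate.  Finally [|x_n - Ttilde_n x_n|] is
   at most [|x_{n+l} - x_n|] plus the [l] one-step errors. *)

(** * Norm bounds obtained from quadratic forms *)

Section HilbertOperators.
Context {R : realType} {H : completeNormedModType R} (dot : {dot H for idfun}).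
Context (Hdot : induces_norm dot).

Lemma dot_ge0 (x : H) : 0 <= dot x x.
Proof.
have [->|x0] := eqVneq x 0; first by rewrite linear0l.
by have /ltW := @neq0_dnorm_gt0 _ _ _ dot x x0.
Qed.

Lemma dot_sqnorm (x : H) : dot x x = `|x| ^+ 2.
Proof. by rewrite Hdot sqr_sqrtr // dot_ge0. Qed.

Lemma dotC (x y : H) : dot x y = dot y x.
Proof. by rewrite (hermC dot) expr0 mul1r. Qed.

Lemma dotBZ (x y z w : H) (t : R) :
  dot (x - t *: y) (z - t *: w) =
  dot x z - t * dot x w - t * dot y z + t ^+ 2 * dot y w.
Proof.
by rewrite linearBl !linearBr !linearZl_LR !linearZr_LR /=; ring.
Qed.

(* Expand [0 <= dot (B v) v] at [v = x - t *: B x], with [t = c^-1]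
   (or [t = 1] when [c = 0]). *)
Lemma norm_le_psd (B : {linear H -> H}) (c : R) :
  self_adjoint dot B -> 0 <= c ->
  (forall x, 0 <= dot (B x) x <= c * `|x| ^+ 2) ->
  forall x, `|B x| <= c * `|x|.
Proof.
move=> Bsym c0 Bc x.
have key t : 0 <= c * `|x| ^+ 2 - 2 * t * `|B x| ^+ 2 + t ^+ 2 * (c * `|B x| ^+ 2).
  have /andP[_ h1] := Bc x; have /andP[_ h2] := Bc (B x).
  have /andP[h3 _] := Bc (x - t *: B x).
  apply: (le_trans h3).
  rewrite (linearB B) (linearZ_LR B) /= dotBZ (Bsym (B x) x) dot_sqnorm.
  have := ler_wpM2l (sqr_ge0 t) h2.
  by move: h1; lra.
have [c_eq0|c_neq0] := eqVneq c 0.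
  have := key 1; rewrite c_eq0 !mul0r => h.
  by rewrite normr_le0 -normr_eq0 -sqrf_eq0; apply/eqP; have := sqr_ge0 `|B x|; lra.
have c_gt0 : 0 < c by rewrite lt_neqAle eq_sym c_neq0.
rewrite -(@ler_pXn2r _ 2) ?nnegrE ?mulr_ge0 // exprMn.
have := ler_wpM2l c0 (key c^-1).
have -> : c * (c * `|x| ^+ 2 - 2 * c^-1 * `|B x| ^+ 2 + c^-1 ^+ 2 * (c * `|B x| ^+ 2))
   = c ^+ 2 * `|x| ^+ 2 - `|B x| ^+ 2 by field.
lra.
Qed.

(** The quadratic form of the self-adjoint operator [I - a A] is nonnegative because [a * b <= 1],
    and strong positivity bounds it above by [1 - a * gamma] times the squared norm, so
    [norm_le_psd] applies. *)
Lemma contraction_idB (A : {linear H -> H}) (gamma a b : R) :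
  0 < b -> self_adjoint dot A -> strongly_positive dot A gamma ->
  (forall y, `|A y| <= b * `|y|) -> 0 <= a -> a * b <= 1 -> a * gamma <= 1 ->
  forall x, `|x - a *: A x| <= (1 - a * gamma) * `|x|.
Proof.
move=> b_gt0 Asym Apos Ab a0 ab1 agamma1.
pose B : {linear H -> H} := (idfun \- (a \*: A))%R.
have BE y : B y = y - a *: A y by [].
suff /norm_le_psd : self_adjoint dot B.
  move=> /(_ (1 - a * gamma)) + x; rewrite -BE; apply; first by rewrite subr_ge0.
  move=> y; rewrite BE linearBl linearZl_LR /= dot_sqnorm.
  apply/andP; split; last first.
    by have := ler_wpM2l a0 (Apos y); rewrite mulrA; lra.
  (* Cauchy-Schwarz in disguise: expand the square of [A y - b *: y], bound [|A y|] by [b |y|], and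
     divide by [2 b]. *)
  have Ay_le : dot (A y) y <= b * `|y| ^+ 2.
    have := dot_ge0 (A y - b *: y).
    rewrite dotBZ !dot_sqnorm (dotC y (A y)) => h.
    have : `|A y| ^+ 2 <= b ^+ 2 * `|y| ^+ 2.
      by rewrite -exprMn ler_pXn2r ?nnegrE ?mulr_ge0 ?(ltW b_gt0).
    move=> h1; rewrite -(ler_pM2l b_gt0); lra.
  have := ler_wpM2l a0 Ay_le.
  have := ler_wpM2r (sqr_ge0 `|y|) ab1.
  lra.
move=> y z; rewrite !BE linearBl linearBr linearZl_LR linearZr_LR /=.
by rewrite Asym.
Qed.

End HilbertOperators.

(** * Auxiliary estimates: operator norm, recursions, sums *)

Lemma opnorm_le (R : realType) (V : normedModType R) (A : {linear V -> V})
    (b : R) :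
  bounded_operator A -> opnorm A <= b -> forall x, `|A x| <= b * `|x|.
Proof.
move=> [M AM] Ab x.
have [->|x0] := eqVneq x 0; first by rewrite linear0 !normr0 mulr0.
have nx0 : 0 < `|x| by rewrite normr_gt0.
rewrite -ler_pdivrMr //; apply: le_trans Ab.
apply: ub_le_sup.
  exists `|M| => _ [y /= y1 <-]; apply: (le_trans (AM y)).
  apply: (@le_trans _ _ (`|M| * `|y|)); first by rewrite ler_wpM2r ?ler_norm.
  by rewrite ler_piMr.
exists (`|x|^-1 *: x) => /=.
  by rewrite normrZ normfV normr_id mulVf ?gt_eqF.
by rewrite linearZ normrZ normfV normr_id mulrC.
Qed.

Lemma nceil_ge (R : realType) (r : R) : 0 <= r -> r <= (nceil r)%:R.
Proof.
move=> r0; apply: (le_trans (ceil_ge r)); rewrite /nceil.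
by rewrite pmulrn ler_int lez_abs.
Qed.

(** In the induction the weights [1 - a n] and [a n] reproduce [eps], while
    [1 - a n <= expR (- a n)] adds one term to the exponent. *)
Lemma contractive_recursion_le (R : realType) (s a : nat -> R) (N n : nat)
    (M eps : R) :
  0 <= M -> s N <= M -> (N <= n)%N ->
  (forall i, (N <= i)%N -> a i <= 1) ->
  (forall i, (N <= i)%N -> s i.+1 <= (1 - a i) * s i + a i * eps) ->
  0 <= eps -> s n <= expR (- \sum_(N <= i < n) a i) * M + eps.
Proof.
move=> M0 sN + a1 sS eps0; elim: n => [|n IHn].
  by rewrite leqn0 => /eqP N0; rewrite -N0 big_geq // oppr0 expR0; lra.
rewrite leq_eqVlt => /predU1P[<-|].
  by rewrite big_geq // oppr0 expR0; lra.
rewrite ltnS => Nn; apply: (le_trans (sS _ Nn)).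
rewrite big_nat_recr //= opprD expRD.
set E := expR (- \sum_(_ <= _ < _) _) in IHn *.
have a1n : 0 <= 1 - a n by rewrite subr_ge0 a1.
have h1 := ler_wpM2l a1n (IHn Nn).
have h2 : (1 - a n) * (E * M) <= expR (- a n) * (E * M).
  by rewrite ler_wpM2r ?mulr_ge0 ?expR_ge0 ?expR_ge1Dx.
lra.
Qed.

(** Each further map adds one new one-step error and, being nonexpansive, does not enlarge those
    already accumulated. *)
Lemma seqcomp_dist_le (R : realType) (V : normedModType R) (T : nat -> V -> V)
    (x : nat -> V) (n m : nat) (eps : R) :
  (forall i, nonexpansive (T i)) ->
  (forall i, (n <= i)%N -> `|x i.+1 - T i.+1 (x i)| <= eps) ->
  `|x (n + m)%N - seqcomp T n m (x n)| <= m%:R * eps.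
Proof.
move=> Tne xT; elim: m => [|m IHm] /=; first by rewrite addn0 subrr normr0 mul0r.
rewrite addnS -(subrKA (T (n + m).+1 (x (n + m)%N))).
apply: (le_trans (ler_normD _ _)).
have := xT _ (leq_addr m n).
have := le_trans (Tne (n + m).+1 _ _) IHm.
rewrite -natr1; lra.
Qed.

Lemma sum_le_size (R : realType) (a : nat -> R) :
  (forall n, a n <= 1) -> forall m n, \sum_(m <= i < n) a i <= (n - m)%:R.
Proof.
move=> a1 m n; apply: (le_trans (ler_sum _ (fun i _ => a1 i))).
by rewrite big_const_nat iter_addr_0.
Qed.

(** * Boundedness and difference estimates for the iteration *)

Section XuIteration.
Context {R : realType} {V : normedModType R} (A : {linear V -> V})
  (T : nat -> V -> V) (u p : V) (alpha : nat -> R) (x : nat -> V)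
  (gamma b K : R) (Q l : nat).
Context (Tne : forall n, nonexpansive (T n)) (Tp : forall n, T n p = p)
  (Tper : forall n, T (n + l)%N = T n)
  (xS : xu_iteration A T u alpha x)
  (alpha_ge0 : forall n, 0 <= alpha n)
  (b_ge0 : 0 <= b)
  (alphagamma : forall n, alpha n * gamma <= 1) (gamma1 : gamma <= 1)
  (Ab : forall y, `|A y| <= b * `|y|)
  (Acontr : forall n, (Q < n)%N ->
     forall y, `|y - alpha n *: A y| <= (1 - alpha n * gamma) * `|y|)
  (xQ : `|x Q - p| <= K) (up : `|u - A p| <= K * gamma).

Let affine_stepE (a : R) (y : V) : y - a *: A y + a *: u = y + a *: (u - A y).
Proof. by rewrite scalerBr addrA addrAC. Qed.

(** Separates a part controlled by contraction from one due to unequal step sizes. It serves twice: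
    against [p] (with [c = 0]) and between iterates [l] apart. *)
Let affine_stepB (a c : R) (y z : V) :
  y + a *: (u - A y) - (z + c *: (u - A z)) =
  (y - z - a *: A (y - z)) + (a - c) *: (u - A z).
Proof.
rewrite opprD addrACA -[RHS]addrA; congr (_ + _).
rewrite scalerBl addrA; congr (_ - _).
by rewrite (linearB A) -scalerN -scalerDr opprB [in RHS]addrC subrKA.
Qed.

Lemma xu_dist_le n : (Q <= n)%N -> `|x n - p| <= K.
Proof.
move/subnK<-; elim: (n - Q)%N => [//|k IHk]; rewrite addSn xS affine_stepE.
set m := (k + Q)%N in IHk *; set a := alpha m.+1.
(* Here [p] is a step of size [0] from itself; the resulting bound is [(1 - a * gamma) * K + a * (K
   * gamma) = K]. *)
rewrite -[p in X in X <= _](addr0 p) -(scale0r (u - A p)) affine_stepB subr0.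
apply: (le_trans (ler_normD _ _)); rewrite normrZ ger0_norm ?alpha_ge0 //.
have Qm : (Q < m.+1)%N by rewrite ltnS leq_addl.
have := Acontr Qm (T m.+1 (x m) - p); rewrite -/a.
have : `|T m.+1 (x m) - p| <= K.
  by rewrite -{1}(Tp m.+1); apply: (le_trans (Tne m.+1 _ _) IHk).
have ag1 : 0 <= 1 - a * gamma by rewrite subr_ge0 alphagamma.
move=> /(ler_wpM2l ag1).
have := ler_wpM2l (alpha_ge0 m.+1) up; rewrite -/a.
lra.
Qed.

Let residual_le n : (Q <= n)%N -> `|u - A (T n.+1 (x n))| <= (b + 1) * K.
Proof.
move=> Qn; have K0 : 0 <= K by apply: le_trans xQ.
rewrite -(subrKA (A p)) -(linearB A).
apply: (le_trans (ler_normD _ _)).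
have Tx : `|p - T n.+1 (x n)| <= K.
  by rewrite distrC -{1}(Tp n.+1); apply: (le_trans (Tne n.+1 _ _) (xu_dist_le Qn)).
have := le_trans (Ab _) (ler_wpM2l b_ge0 Tx).
have := ler_wpM2l K0 gamma1; move: up; lra.
Qed.

Lemma xu_step_le n : (Q <= n)%N ->
  `|x n.+1 - T n.+1 (x n)| <= alpha n.+1 * ((b + 1) * K).
Proof.
move=> Qn; rewrite xS affine_stepE addrAC subrr add0r.
by rewrite normrZ ger0_norm // ler_wpM2l // residual_le.
Qed.

(** By periodicity both iterates apply the same map [T n.+1], so its nonexpansiveness carries the
    distance back to index [n]. *)
Lemma xu_shift_le n : (Q <= n)%N ->
  `|x (n.+1 + l)%N - x n.+1| <=
    (1 - alpha (n.+1 + l)%N * gamma) * `|x (n + l)%N - x n|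
    + `|alpha (n.+1 + l)%N - alpha n.+1| * ((b + 1) * K).
Proof.
move=> Qn; rewrite !addSn !xS -!addSn Tper.
set a := alpha (n.+1 + l)%N; set c := alpha n.+1.
set y := T n.+1 (x (n + l)%N); set z := T n.+1 (x n).
rewrite !affine_stepE affine_stepB.
apply: (le_trans (ler_normD _ _)); rewrite normrZ.
apply: lerD; last by rewrite ler_wpM2l // residual_le.
apply: (@le_trans _ _ ((1 - a * gamma) * `|y - z|)).
  by apply: Acontr; rewrite addSn ltnS (leq_trans Qn) ?leq_addr.
by rewrite ler_wpM2l ?subr_ge0 ?alphagamma //; apply: Tne.
Qed.

End XuIteration.

(** * Extraction of the rates *)

Theorem proposition7
  (R : realType) (H : completeNormedModType R) (dot : {dot H for idfun})
  (Hdot : induces_norm dot)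
  (A : {linear H -> H}) (gamma : R)
  (A_bounded : bounded_operator A)
  (A_self_adjoint : self_adjoint dot A)
  (gamma_gt0 : 0 < gamma) (gamma_le1 : gamma <= 1)
  (A_pos : strongly_positive dot A gamma)
  (l : nat) (l_ge1 : (1 <= l)%N)
  (T : nat -> H -> H)
  (T_nonexp : forall i : nat, (i < l)%N -> nonexpansive (T i))
  (T_cyclic : forall n : nat, (l <= n)%N -> T n = T (n %% l)%N)
  (u : H) (alpha : nat -> R)
  (alpha01 : forall n : nat, 0 < alpha n <= 1)
  (x : nat -> H) (x_xu : xu_iteration A T u alpha x)
  (p : H) (p_in_F : (\bigcap_(i in `I_l) Fix (T i)) p)
  (bA : nat) (bA_gt0 : (0 < bA)%N) (bA_ge : opnorm A <= bA%:R)
  (sigma1 sigma2 sigma3 : nat -> nat)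
  (sigma1_incr : {homo sigma1 : m n / (m <= n)%N})
  (sigma2_incr : {homo sigma2 : m n / (m <= n)%N})
  (sigma3_incr : {homo sigma3 : m n / (m <= n)%N})
  (HC1q : C1q alpha sigma1) (HC2q : C2q alpha sigma2)
  (HC3q : C3q alpha l sigma3)
  (K : nat) (K_gt0 : (0 < K)%N)
  (K_ge : Num.max `|x (rateQ bA sigma1) - p| (`|u - A p| / gamma) <= K%:R) :
  asymptotically_regular_with_rate (Ttilde T l) x
    (ratePhi gamma l bA K sigma1 sigma2 sigma3).
Proof.
have alpha_ge0 n : 0 <= alpha n by case/andP: (alpha01 n) => /ltW.
have alpha1 n : alpha n <= 1 by case/andP: (alpha01 n).
have gamma_ge0 := ltW gamma_gt0.
have alphagamma n : alpha n * gamma <= 1 by rewrite mulr_ile1.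
have T_mod n : T n = T (n %% l)%N.
  by have [nl|/T_cyclic//] := ltnP n l; rewrite modn_small.
have Tne n : nonexpansive (T n) by rewrite T_mod; apply: T_nonexp; rewrite ltn_mod.
have Tp n : T n p = p by rewrite T_mod; apply: p_in_F; rewrite /= ltn_mod.
have Tper n : T (n + l)%N = T n by rewrite T_mod modnDr -T_mod.
have Ab := opnorm_le A_bounded bA_ge.
have b_gt0 : 0 < bA%:R :> R by rewrite ltr0n.
have b_ge0 := ltW b_gt0.
pose Q := rateQ bA sigma1.
have Acontr n : (Q < n)%N ->
    forall y, `|y - alpha n *: A y| <= (1 - alpha n * gamma) * `|y|.
  move=> Qn; apply: (contraction_idB Hdot b_gt0) => //.
  have /HC1q : (sigma1 (bA - 1) <= n)%N by move: Qn; rewrite /Q /rateQ; clear; lia.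
  by rewrite subn1 prednK // ler_pdivlMr.
move: K_ge; rewrite ge_max -/Q ler_pdivrMr // => /andP[xQ up].
pose C : R := (bA%:R + 1) * K%:R.
have K_ge0 : 0 <= K%:R :> R by [].
have C_gt0 : 0 < C by rewrite mulr_gt0 ?ltr0n // ltr_wpDl.
have step n k : (ratePsi bA K sigma1 k <= n)%N ->
    `|x n.+1 - T n.+1 (x n)| <= 1 / k.+1%:R.
  move=> Psin.
  (* The estimates for the iteration hold from [Q] on; monotonicity of [sigma1] puts the present
     index there, as [bA <= (bA + 1) * K * (k + 1)]. *)
  have QPsi : (Q <= ratePsi bA K sigma1 k)%N.
    rewrite leq_sub2r // sigma1_incr // leq_sub2r // -mulnA.
    by apply: (leq_trans (leq_addr 1 bA)); rewrite leq_pmulr // muln_gt0 K_gt0 addn1.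
  have Qn := leq_trans QPsi Psin.
  have := xu_step_le Tne Tp x_xu alpha_ge0 b_ge0 alphagamma gamma_le1 Ab Acontr
    xQ up Qn.
  move/le_trans; apply.
  have /HC1q : (sigma1 ((bA + 1) * K * (k + 1) - 1) <= n.+1)%N.
    by move: Psin; rewrite /ratePsi -addn1; clear; lia.
  have -> : ((bA + 1) * K * (k + 1) - 1).+1 = ((bA + 1) * K * k.+1)%N.
    by rewrite !addn1 subn1 prednK // !muln_gt0 K_gt0.
  move/(ler_wpM2r (ltW C_gt0)); rewrite -/C => /le_trans; apply.
  rewrite !natrM natrD le_eqVlt; apply/orP; left; apply/eqP.
  by rewrite /C; field; rewrite nat1r natr1 !pnatr_eq0 -!lt0n K_gt0.
have shift n k : rateSigma gamma l bA K sigma1 sigma2 sigma3 k <= n%:Z ->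
    `|x (n + l)%N - x n| <= 1 / k.+1%:R.
  rewrite /rateSigma -/Q lerBlDr -PoszD lez_nat.
  set N := ratepsi gamma bA K sigma1 sigma3 (2 * k + 1).
  set L := nceil (ln _); set M := nceil (_ / gamma) => sigma2_le.
  have NLM : N%:R + L%:R <= gamma * M%:R.
    rewrite mulrC -ler_pdivrMr //; apply: nceil_ge.
    by rewrite divr_ge0 // addr_ge0.
  have N_le_M : (N <= M)%N.
    rewrite -(ler_nat R); apply: le_trans (ler_piMl _ gamma_le1) => //.
    by apply: le_trans NLM; rewrite lerDl.
  have sum_ge : (M + Q + l + 1)%:R <= \sum_(0 <= i < (n + l).+1) alpha i.
    apply: (le_trans (HC2q _)).
    rewrite [leRHS](@big_cat_nat _ _ _ (sigma2 (M + Q + l + 1)%N).+1) //=.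
    by rewrite lerDl sumr_ge0.
  (* A sum of [n + l + 1] terms, each at most 1, reaches [M + Q + l + 1], so [M + Q <= n]. *)
  have QNn : (Q + N <= n)%N.
    have := le_trans sum_ge (sum_le_size alpha1 _ _).
    by rewrite ler_nat; move: N_le_M; clear; lia.
  (* The first [Q + N + l + 1] terms are bounded by 1 each; the tail, reindexed by [l + 1], keeps at
     least [M - N]. *)
  have sum_ge' : (M + Q + l + 1)%:R <= (Q + N + l + 1)%:R
      + \sum_(Q + N <= i < n) alpha (i.+1 + l)%N.
    apply: (le_trans sum_ge).
    rewrite (@big_cat_nat _ _ _ (Q + N + l.+1)) //=; [|by move: QNn; clear; lia].
    apply: lerD.
      have := sum_le_size alpha1 0 (Q + N + l.+1).
      by rewrite subn0 addn1 addnS.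
    rewrite big_addn -addnS addnK le_eqVlt; apply/orP; left; apply/eqP.
    by apply: eq_bigr => i _; rewrite addnS addSn.
  (* Half of the target: the other half is left for the exponential term. *)
  pose eps : R := 1 / (2 * k.+1%:R).
  have eps_ge0 : 0 <= eps by rewrite divr_ge0.
  pose a i := alpha (i.+1 + l)%N * gamma.
  pose s i := `|x (i + l)%N - x i|.
  have sS i : (Q + N <= i)%N -> s i.+1 <= (1 - a i) * s i + a i * eps.
    move=> QNi; have Qi : (Q <= i)%N by apply: leq_trans QNi; apply: leq_addr.
    apply: (le_trans (xu_shift_le Tne Tp Tper x_xu alpha_ge0 b_ge0 alphagamma gamma_le1
      Ab Acontr xQ up Qi)).
    rewrite lerD2l -/C /a; set c := alpha (i.+1 + l)%N.
    have c_gt0 : 0 < c by case/andP: (alpha01 (i.+1 + l)%N).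
    (* [D] cancels: (C3q) at [D * (2 * k.+1) - 1] bounds the step difference by
       [c / (D * (2 * k.+1))], and [C <= gamma * D] turns the error into [a i * eps]. *)
    pose D := nceil ((bA + 1)%:R * K%:R / gamma).
    have CD : C <= gamma * D%:R.
      by rewrite mulrC -ler_pdivrMr // /C natr1 -addn1; apply: nceil_ge; rewrite divr_ge0.
    have D_gt0 : (0 < D)%N.
      by rewrite -(ltr0n R) -(pmulr_rgt0 _ gamma_gt0); apply: lt_le_trans CD.
    have /HC3q : (sigma3 (D * (2 * k + 1 + 1) - 1) <= i.+1)%N.
      by move: QNi; rewrite /N /ratepsi -/Q -/D; clear; lia.
    have -> : (D * (2 * k + 1 + 1) - 1).+1 = (D * (2 * k.+1))%N.
      rewrite subn1 prednK; last by rewrite muln_gt0 D_gt0 addn1.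
      by congr (D * _)%N; clear; lia.
    rewrite !natrM -/c => /(ler_wpM2l (ltW c_gt0)).
    rewrite -{1}(gtr0_norm c_gt0) -normrM mulrBr mulr1 mulrCA divff ?gt_eqF //.
    rewrite mulr1 distrC => diff_le.
    apply: (le_trans (ler_wpM2r (ltW C_gt0) diff_le)).
    apply: (le_trans (ler_wpM2l _ CD)).
      by rewrite mulr_ge0 ?divr_ge0 ?mulr_ge0 // ltW.
    rewrite le_eqVlt /eps; apply/orP; left; apply/eqP.
    by field; rewrite nat1r !pnatr_eq0 -!lt0n D_gt0.
  have sN : s (Q + N)%N <= 2 * K%:R.
    have bnd := xu_dist_le Tne Tp x_xu alpha_ge0 alphagamma Acontr xQ up.
    rewrite /s -(subrKA p); apply: (le_trans (ler_normD _ _)).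
    have -> : 2 * K%:R = K%:R + K%:R :> R by ring.
    by rewrite (distrC p) lerD // bnd // -?addnA leq_addr.
  have := @contractive_recursion_le R s a (Q + N) n (2 * K%:R) eps _ sN QNn.
  move=> /(_ _ _ sS eps_ge0) sn; apply: (le_trans (sn _ _)) => [||{sn}].
  - by rewrite mulr_ge0.
  - by move=> i _; apply: alphagamma.
  have kn0 : k.+1%:R != 0 :> R by rewrite pnatr_eq0.
  have Kn0 : K%:R != 0 :> R by rewrite pnatr_eq0 -lt0n.
  (* Chosen so that [2 * K / W = eps], where [2 * K] bounds the initial distance [s (Q + N)]. *)
  pose W : R := 4 * K%:R * (k + 1)%:R.
  have W_gt0 : 0 < W by rewrite !mulr_gt0 ?ltr0n // addn1.
  (* With [S] the tail sum of [alpha]: [ln W <= L <= gamma * M - N <= gamma * (M - N) <= gamma * S],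
     the third inequality by [gamma <= 1]. *)
  have sum_ln : ln W <= \sum_(Q + N <= i < n) a i.
    rewrite -mulr_suml; set S := \sum_(_ <= _ < _) _.
    have lnW : ln W <= L%:R.
      apply: nceil_ge; rewrite ln_ge0 // /W -!natrM ler1n.
      by rewrite !muln_gt0 K_gt0 addn1.
    have := sum_ge'; rewrite -/S !natrD => h.
    have := ler_wpM2r gamma_ge0 (_ : M%:R - N%:R <= S).
    have := ler_piMr (ler0n R N) gamma_le1.
    move=> h1 h2; have := h2 ltac:(lra); lra.
  have /(ler_wpM2r (mulr_ge0 (ler0n R 2) K_ge0)) :
      expR (- \sum_(Q + N <= i < n) a i) <= W^-1.
    by rewrite expRN lef_pV2 ?posrE ?expR_gt0 // -ler_ln ?posrE ?expR_gt0 // expRK.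
  have -> : W^-1 * (2 * K%:R) = eps.
    by rewrite /W /eps addn1; field; rewrite nat1r kn0.
  have -> : 1 / k.+1%:R = eps + eps by rewrite /eps; field; rewrite nat1r.
  by rewrite lerD2r.
move=> k n; rewrite /ratePhi ge_max => /andP[/shift xshift].
(* One shift error and [l] one-step errors, each at most [1 / ((l + 1) * k.+1)], add up to
   [1 / k.+1]. *)
set k' := ((l + 1) * (k + 1) - 1)%N in xshift *.
have k'E : k'.+1 = ((l + 1) * k.+1)%N by rewrite /k' !addn1 subn1 prednK.
rewrite lez_nat => Psin.
have xT i : (n <= i)%N -> `|x i.+1 - T i.+1 (x i)| <= 1 / k'.+1%:R.
  by move=> ni; apply: step; apply: leq_trans ni.
rewrite /Ttilde -(subrKA (x (n + l)%N)); apply: (le_trans (ler_normD _ _)).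
rewrite distrC; apply: (le_trans (lerD xshift (seqcomp_dist_le l Tne xT))).
rewrite k'E natrM natrD le_eqVlt; apply/orP; left; apply/eqP.
have : k.+1%:R != 0 :> R by rewrite pnatr_eq0.
have : l%:R + 1 != 0 :> R by rewrite natr1 pnatr_eq0.
by move=> ? ?; field; apply/andP.
Qed.
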